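(* Let $C$ be an additive left group code in $KG$, and let $\langle\cdot,\cdot\rangle_\star$ denote either the trace-Euclidean form or, when $m$ is even, the trace-Hermitian form. Then there is a natural isomorphism of left $FG$-modules $KG/C^{\perp_\star}\cong C^*$, where $C^*=\operatorname{Hom}_F(C,F)$.
   Context: $F=\mathbb{F}_q$ is a finite field, $K=\mathbb{F}_{q^m}$ is its extension of degree $m$, $G$ is a finite group, and $FG\subseteq KG$ are the group algebras; $KG$ is viewed as a left $FG$-module. An additive left group code is a left $FG$-submodule $C\leq KG$. For $x=\sum_{g\in G}a_g g$ and $y=\sum_{g\in G}b_g g$ in $KG$, the trace-Euclidean form is $\langle x,y\rangle_{\mathrm{TE}}=\operatorname{Tr}_{K/F}\left(\sum_{g\in G}a_gb_g\right)$ and, when $m$ is even, the trace-Hermitian form is $\langle x,y\rangle_{\mathrm{TH}}=\operatorname{Tr}_{K/F}\left(\sum_{g\in G}a_g\overline{b_g}\right)$, where $\overline{b}=b^{q^{m/2}}$. $C^{\perp_\star}=\{x\in KG:\langle x,c\rangle_\star=0\text{ for all }c\in C\}$ (a left $FG$-submodule of $KG$). For a left $FG$-module $M$, $M^*=\operatorname{Hom}_F(M,F)$ is a left $FG$-module via $(g\cdot f)(x)=f(g^{-1}x)$ for $g\in G$, $f\in M^*$, $x\in M$, extended $F$-linearly to $FG$. *)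

(* Defs.v *)
From HB Require Import structures.
From mathcomp Require Import all_boot all_fingroup all_algebra all_field.
From mathcomp Require Import boolp.

Set Implicit Arguments.
Unset Strict Implicit.
Unset Printing Implicit Defensive.

Import GRing.Theory.
Local Open Scope ring_scope.

(* The group algebra: functions G -> R under convolution.  It is a separate   *)
(* constant because {ffun G -> R} carries the pointwise product.              *)
Definition group_algebra (R : comNzRingType) (G : finGroupType) : Type :=
  {ffun G -> R}.

Section GroupAlgebra.
Variables (R : comNzRingType) (G : finGroupType).
Local Notation RG := (group_algebra R G).

HB.instance Definition _ := GRing.Lmodule.copy RG {ffun G -> R^o}.

Implicit Types x y z : RG.

Definition ga_coef x (g : G) : R := (x : {ffun G -> R}) g.

Definition ga_elt (g : G) : RG := [ffun h => (h == g)%:R].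

Definition ga_mul x y : RG :=
  [ffun g => \sum_(h : G) ga_coef x h * ga_coef y (h^-1 * g)%g].

Lemma ga_eqP x y : (forall g, ga_coef x g = ga_coef y g) -> x = y.
Proof. by move=> e; apply/ffunP. Qed.

Lemma ga_coefD x y g : ga_coef (x + y) g = ga_coef x g + ga_coef y g.
Proof. by rewrite /ga_coef ffunE. Qed.

Lemma ga_coef0 g : ga_coef 0 g = 0.
Proof. by rewrite /ga_coef ffunE. Qed.

Lemma ga_coefZ (c : R) x g : ga_coef (c *: x) g = c * ga_coef x g.
Proof. by rewrite /ga_coef ffunE. Qed.

Lemma ga_coef_sum I (r : seq I) P (f : I -> RG) g :
  ga_coef (\sum_(i <- r | P i) f i) g = \sum_(i <- r | P i) ga_coef (f i) g.
Proof.
apply: (big_morph (fun x => ga_coef x g)); last exact: ga_coef0.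
by move=> x y; rewrite ga_coefD.
Qed.

Lemma ga_coef_elt g h : ga_coef (ga_elt g) h = (h == g)%:R.
Proof. by rewrite /ga_coef ffunE. Qed.

Lemma ga_coef_mul x y g :
  ga_coef (ga_mul x y) g = \sum_(h : G) ga_coef x h * ga_coef y (h^-1 * g)%g.
Proof. by rewrite {1}/ga_coef ffunE. Qed.

Fact ga_mulA : associative ga_mul.
Proof.
move=> x y z; apply: ga_eqP => g; rewrite !ga_coef_mul.
under [RHS]eq_bigr do rewrite ga_coef_mul mulr_suml.
rewrite exchange_big; apply: eq_bigr => h _ /=.
rewrite ga_coef_mul mulr_sumr (reindex_inj (mulgI h^-1%g)).
apply: eq_bigr => k _.
by rewrite mulrA invMg invgK -!mulgA mulKVg.
Qed.

Fact ga_mul1 : left_id (ga_elt 1%g) ga_mul.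
Proof.
move=> x; apply: ga_eqP => g; rewrite ga_coef_mul (bigD1 1%g) //= big1 ?addr0.
  by rewrite ga_coef_elt eqxx mul1r invg1 mul1g.
by move=> h /negbTE; rewrite ga_coef_elt => ->; rewrite mul0r.
Qed.

Fact ga_mulr1 : right_id (ga_elt 1%g) ga_mul.
Proof.
move=> x; apply: ga_eqP => g; rewrite ga_coef_mul (bigD1 g) //= big1 ?addr0.
  by rewrite ga_coef_elt mulVg eqxx mulr1.
move=> h nhg; rewrite ga_coef_elt.
suff /negbTE -> : (h^-1 * g)%g != 1%g by rewrite mulr0.
by apply: contraNneq nhg => e; rewrite -(mulKVg h g) e mulg1.
Qed.

Fact ga_mulDl : left_distributive ga_mul +%R.
Proof.
move=> x y z; apply: ga_eqP => g; rewrite ga_coefD !ga_coef_mul -big_split.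
by apply: eq_bigr => h _; rewrite ga_coefD mulrDl.
Qed.

Fact ga_mulDr : right_distributive ga_mul +%R.
Proof.
move=> x y z; apply: ga_eqP => g; rewrite ga_coefD !ga_coef_mul -big_split.
by apply: eq_bigr => h _; rewrite ga_coefD mulrDr.
Qed.

Fact ga_oner_neq0 : ga_elt 1%g != 0.
Proof.
apply/eqP => /(congr1 (fun x => ga_coef x 1%g)).
by rewrite ga_coef_elt ga_coef0 eqxx => /eqP; rewrite oner_eq0.
Qed.

HB.instance Definition _ := GRing.Zmodule_isNzRing.Build RG
  ga_mulA ga_mul1 ga_mulr1 ga_mulDl ga_mulDr ga_oner_neq0.

Lemma ga_coefM x y g :
  ga_coef (x * y) g = \sum_(h : G) ga_coef x h * ga_coef y (h^-1 * g)%g.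
Proof. exact: ga_coef_mul. Qed.

Fact ga_scalerAl (c : R) x y : c *: (x * y) = (c *: x) * y.
Proof.
apply: ga_eqP => g; rewrite ga_coefZ !ga_coefM mulr_sumr.
by apply: eq_bigr => h _; rewrite ga_coefZ mulrA.
Qed.

HB.instance Definition _ := GRing.Lmodule_isLalgebra.Build R RG ga_scalerAl.

Fact ga_scalerAr (c : R) x y : c *: (x * y) = x * (c *: y).
Proof.
apply: ga_eqP => g; rewrite ga_coefZ !ga_coefM mulr_sumr.
by apply: eq_bigr => h _; rewrite ga_coefZ mulrCA.
Qed.

HB.instance Definition _ := GRing.Lalgebra_isAlgebra.Build R RG ga_scalerAr.

Lemma ga_eltM g h : ga_elt (g * h)%g = ga_elt g * ga_elt h.
Proof.
apply: ga_eqP => k; rewrite ga_coefM (bigD1 g) //= big1 ?addr0.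
  by rewrite !ga_coef_elt eqxx mul1r -[in RHS](inj_eq (mulgI g)) mulKVg.
by move=> i /negbTE; rewrite ga_coef_elt => ->; rewrite mul0r.
Qed.

Lemma ga_elt1 : ga_elt 1%g = 1. Proof. by []. Qed.

Lemma ga_sumE x : x = \sum_(g : G) ga_coef x g *: ga_elt g.
Proof.
apply: ga_eqP => h; rewrite ga_coef_sum (bigD1 h) //= big1 ?addr0.
  by rewrite ga_coefZ ga_coef_elt eqxx mulr1.
by move=> g; rewrite eq_sym ga_coefZ ga_coef_elt => /negbTE ->; rewrite mulr0.
Qed.

End GroupAlgebra.

Arguments ga_elt {R G} g.

(* KG as a left FG-module; group_algebra K G is already a left K-module.      *)
Definition ambient (F : finFieldType) (K : fieldExtType F) (G : finGroupType)
  : Type := group_algebra K G.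

Section Ambient.
Variables (F : finFieldType) (K : fieldExtType F) (G : finGroupType).
Local Notation FG := (group_algebra F G).
Local Notation KG := (group_algebra K G).
Local Notation V := (ambient K G).

Definition ga_incl (a : FG) : KG := [ffun g => (ga_coef a g)%:A].

Lemma ga_coef_incl a g : ga_coef (ga_incl a) g = (ga_coef a g)%:A.
Proof. by rewrite {1}/ga_coef ffunE. Qed.

Lemma ga_inclD a b : ga_incl (a + b) = ga_incl a + ga_incl b.
Proof.
by apply: ga_eqP => g; rewrite ga_coefD !ga_coef_incl ga_coefD scalerDl.
Qed.

Lemma ga_inclM a b : ga_incl (a * b) = ga_incl a * ga_incl b.
Proof.
apply: ga_eqP => g; rewrite ga_coefM ga_coef_incl ga_coefM scaler_suml.
by apply: eq_bigr => h _; rewrite !ga_coef_incl -scalerAl mul1r scalerA.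
Qed.

Lemma ga_incl_elt g : ga_incl (ga_elt g) = ga_elt g.
Proof.
by apply: ga_eqP => h; rewrite ga_coef_incl !ga_coef_elt scaler_nat.
Qed.

HB.instance Definition _ := GRing.Zmodule.copy V KG.

Definition ambient_scale (a : FG) (x : V) : V := ga_incl a * (x : KG).

Fact ambient_scaleA a b x :
  ambient_scale a (ambient_scale b x) = ambient_scale (a * b) x.
Proof. by rewrite /ambient_scale ga_inclM mulrA. Qed.

Fact ambient_scale1 : left_id 1 ambient_scale.
Proof. by move=> x; rewrite /ambient_scale -ga_elt1 ga_incl_elt mul1r. Qed.

Fact ambient_scaleDr : right_distributive ambient_scale +%R.
Proof. by move=> a x y; rewrite /ambient_scale mulrDr. Qed.

Fact ambient_scaleDl x : {morph ambient_scale^~ x : a b / a + b}.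
Proof. by move=> a b; rewrite /ambient_scale ga_inclD mulrDl. Qed.

HB.instance Definition _ := GRing.Zmodule_isLmodule.Build FG V
  ambient_scaleA ambient_scale1 ambient_scaleDr ambient_scaleDl.

Lemma ambient_coefZ (a : FG) (x : V) g :
  @ga_coef K G (a *: x) g
  = \sum_(h : G) (ga_coef a h)%:A * @ga_coef K G x (h^-1 * g)%g.
Proof.
rewrite [LHS]ga_coefM; apply: eq_bigr => h _.
by rewrite ga_coef_incl.
Qed.

End Ambient.

Section Submodule.
Variables (A : nzRingType) (V : lmodType A) (N : submodClosed V).

Definition submod : Type := {x : V | x \in N}.
HB.instance Definition _ := SubChoice.on submod.
HB.instance Definition _ := [SubChoice_isSubLmodule of submod by <:].

(* A submodClosed predicate carries no zmodClosed instance in the library, and *)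
(* this is what Quotient.quot is defined for.                                 *)
Definition submod_pred : {pred V} := fun x => x \in N.

Fact submod_pred_zmod : zmod_closed submod_pred.
Proof.
split=> [|x y xN yN]; first exact: rpred0.
by apply: rpredD; rewrite // -scaleN1r; apply: rpredZ.
Qed.
HB.instance Definition _ := GRing.isZmodClosed.Build V submod_pred
  submod_pred_zmod.

Definition quotmod : Type := Quotient.quot submod_pred.
HB.instance Definition _ := ZmodQuotient.on quotmod.
HB.instance Definition _ := Choice.on quotmod.

Definition to_quot (x : V) : quotmod := \pi_quotmod%qT x.

Lemma to_quot_eq x y : (to_quot x = to_quot y) <-> (x - y \in N).
Proof.
rewrite /to_quot -[x - y \in N]/(x - y \in submod_pred) Quotient.idealrBE.
by split=> [->|/eqP].
Qed.

Lemma to_quot_surj q : exists x, to_quot x = q.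
Proof. by exists (generic_quotient.repr q); rewrite /to_quot reprK. Qed.

Lemma to_quotD x y : to_quot (x + y) = to_quot x + to_quot y.
Proof. exact: raddfD. Qed.

Definition quot_scale (a : A) (q : quotmod) : quotmod := to_quot (a *: generic_quotient.repr q).

Lemma quot_scaleE a (x : V) : quot_scale a (to_quot x) = to_quot (a *: x).
Proof.
apply/to_quot_eq; rewrite -scalerBr; apply: rpredZ; apply/to_quot_eq.
exact: reprK.
Qed.

Fact quot_scaleA a b q : quot_scale a (quot_scale b q) = quot_scale (a * b) q.
Proof. by have [x <-] := to_quot_surj q; rewrite !quot_scaleE scalerA. Qed.

Fact quot_scale1 : left_id 1 quot_scale.
Proof. by move=> q; have [x <-] := to_quot_surj q; rewrite quot_scaleE scale1r. Qed.

Fact quot_scaleDr : right_distributive quot_scale +%R.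
Proof.
move=> a p q; have [x <-] := to_quot_surj p; have [y <-] := to_quot_surj q.
by rewrite -to_quotD !quot_scaleE scalerDr to_quotD.
Qed.

Fact quot_scaleDl q : {morph quot_scale^~ q : a b / a + b}.
Proof.
move=> a b; have [x <-] := to_quot_surj q.
by rewrite !quot_scaleE scalerDl to_quotD.
Qed.

HB.instance Definition _ := GRing.Zmodule_isLmodule.Build A quotmod
  quot_scaleA quot_scale1 quot_scaleDr quot_scaleDl.

End Submodule.

Definition restrict_scalars (F : comNzRingType) (G : finGroupType)
  (M : lmodType (group_algebra F G)) : Type := M.

Section Restrict.
Variables (F : comNzRingType) (G : finGroupType).
Variable M : lmodType (group_algebra F G).
Local Notation FG := (group_algebra F G).
Local Notation M0 := (restrict_scalars M).

HB.instance Definition _ := GRing.Zmodule.copy M0 M.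

Definition restrict_scale (c : F) (x : M0) : M0 := (c%:A : FG) *: (x : M).

Fact restrict_scaleA a b x :
  restrict_scale a (restrict_scale b x) = restrict_scale (a * b) x.
Proof. by rewrite /restrict_scale scalerA -scalerAl mul1r scalerA. Qed.

Fact restrict_scale1 : left_id 1 restrict_scale.
Proof. by move=> x; rewrite /restrict_scale !scale1r. Qed.

Fact restrict_scaleDr : right_distributive restrict_scale +%R.
Proof. by move=> a x y; rewrite /restrict_scale scalerDr. Qed.

Fact restrict_scaleDl x : {morph restrict_scale^~ x : a b / a + b}.
Proof. by move=> a b; rewrite /restrict_scale !scalerDl. Qed.

HB.instance Definition _ := GRing.Zmodule_isLmodule.Build F M0
  restrict_scaleA restrict_scale1 restrict_scaleDr restrict_scaleDl.

End Restrict.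

Definition dual (F : comNzRingType) (G : finGroupType)
  (M : lmodType (group_algebra F G)) : Type :=
  {linear restrict_scalars M -> F^o}.

Section Dual.
Variables (F : comNzRingType) (G : finGroupType).
Variable M : lmodType (group_algebra F G).
Local Notation FG := (group_algebra F G).
Local Notation M0 := (restrict_scalars M).
Local Notation D := (dual M).

Definition dual_fun (f : D) (x : M) : F := (f : {linear M0 -> F^o}) x.

Lemma dualP (f g : D) : (forall x, dual_fun f x = dual_fun g x) -> f = g.
Proof.
rewrite /dual_fun; case: f => f [[f1] [f2]]; case: g => g [[g1] [g2]] /= /funext e.
case: _ / e in g1 g2 *; rewrite (Prop_irrelevance f1 g1).
by rewrite (Prop_irrelevance f2 g2).
Qed.

Lemma dual_funD (f : D) x y : dual_fun f (x + y) = dual_fun f x + dual_fun f y.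
Proof. exact: (raddfD (f : {linear M0 -> F^o})). Qed.

Lemma dual_funZ (f : D) c (x : M) : dual_fun f (c%:A *: x) = c * dual_fun f x.
Proof. exact: (linearZ_LR (f : {linear M0 -> F^o}) c (x : M0)). Qed.

Definition mk_dual (u : M -> F) (uD : {morph u : x y / x + y})
    (uZ : forall c x, u (c%:A *: x) = c * u x) : D :=
  let lu : linear (u : M0 -> F^o) := fun c x y =>
    etrans (uD _ _) (congr1 (fun t => t + u y) (uZ c x)) in
  HB.pack_for {linear M0 -> F^o} (u : M0 -> F^o)
    (GRing.isLinear.Build F M0 F^o _ (u : M0 -> F^o) lu).

Lemma mk_dualE u uD uZ x : dual_fun (@mk_dual u uD uZ) x = u x.
Proof. by []. Qed.

HB.instance Definition _ := gen_eqMixin D.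
HB.instance Definition _ := gen_choiceMixin D.

Fact dual_zeroD : {morph (fun _ : M => 0 : F) : x y / x + y}.
Proof. by move=> x y; rewrite addr0. Qed.
Fact dual_zeroZ (c : F) (x : M) : 0 = c * 0 :> F.
Proof. by rewrite mulr0. Qed.
Definition dual_zero : D := mk_dual dual_zeroD dual_zeroZ.

Section Operations.
Variables (a : FG) (f g : D).

Fact dual_oppD : {morph (fun x : M => - dual_fun f x) : x y / x + y}.
Proof. by move=> x y; rewrite dual_funD opprD. Qed.
Fact dual_oppZ c x : - dual_fun f (c%:A *: x) = c * - dual_fun f x.
Proof. by rewrite dual_funZ mulrN. Qed.
Definition dual_opp : D := mk_dual dual_oppD dual_oppZ.

Fact dual_addD :
  {morph (fun x : M => dual_fun f x + dual_fun g x) : x y / x + y}.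
Proof. by move=> x y; rewrite !dual_funD addrACA. Qed.
Fact dual_addZ c x :
  dual_fun f (c%:A *: x) + dual_fun g (c%:A *: x)
  = c * (dual_fun f x + dual_fun g x).
Proof. by rewrite !dual_funZ mulrDr. Qed.
Definition dual_add : D := mk_dual dual_addD dual_addZ.

(* (h . f)(x) = f (h^-1 x), extended F-linearly to FG. *)
Definition dual_scale_fun (x : M) : F :=
  \sum_(h : G) ga_coef a h * dual_fun f (ga_elt h^-1%g *: x).

Fact dual_scaleD : {morph dual_scale_fun : x y / x + y}.
Proof.
move=> x y; rewrite /dual_scale_fun -big_split; apply: eq_bigr => h _ /=.
by rewrite scalerDr dual_funD mulrDr.
Qed.
Fact dual_scaleZ c x : dual_scale_fun (c%:A *: x) = c * dual_scale_fun x.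
Proof.
rewrite /dual_scale_fun mulr_sumr; apply: eq_bigr => h _.
rewrite scalerA mulr_algr -[c *: _]mulr_algl -scalerA dual_funZ.
exact: mulrCA.
Qed.
Definition dual_scale : D := mk_dual dual_scaleD dual_scaleZ.

End Operations.

Fact dual_addA : associative dual_add.
Proof. by move=> f g h; apply: dualP => x; rewrite !mk_dualE addrA. Qed.
Fact dual_addC : commutative dual_add.
Proof. by move=> f g; apply: dualP => x; rewrite !mk_dualE addrC. Qed.
Fact dual_add0 : left_id dual_zero dual_add.
Proof. by move=> f; apply: dualP => x; rewrite !mk_dualE add0r. Qed.
Fact dual_addN : left_inverse dual_zero dual_opp dual_add.
Proof. by move=> f; apply: dualP => x; rewrite !mk_dualE addNr. Qed.

HB.instance Definition _ := GRing.isZmodule.Build D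
  dual_addA dual_addC dual_add0 dual_addN.

Lemma dual_addE (f g : D) x : dual_fun (f + g) x = dual_fun f x + dual_fun g x.
Proof. by []. Qed.

Lemma dual_scale_funE a (f : D) x : dual_fun (dual_scale a f) x
  = \sum_(h : G) ga_coef a h * dual_fun f (ga_elt h^-1%g *: x).
Proof. by []. Qed.

Fact dual_scaleA a b (f : D) :
  dual_scale a (dual_scale b f) = dual_scale (a * b) f.
Proof.
apply: dualP => x; rewrite !dual_scale_funE.
under [RHS]eq_bigr do rewrite ga_coefM mulr_suml.
rewrite exchange_big; apply: eq_bigr => g _.
rewrite dual_scale_funE mulr_sumr [RHS](reindex_inj (mulgI g)).
by apply: eq_bigr => h _; rewrite mulKg invMg ga_eltM -scalerA mulrA.
Qed.

Fact dual_scale1 : left_id 1 dual_scale.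
Proof.
move=> f; apply: dualP => x; rewrite dual_scale_funE.
rewrite -ga_elt1 (bigD1 1%g) //= big1 ?addr0.
  by rewrite ga_coef_elt eqxx mul1r invg1 ga_elt1 scale1r.
by move=> h /negbTE; rewrite ga_coef_elt => ->; rewrite mul0r.
Qed.

Fact dual_scaleDr : right_distributive dual_scale +%R.
Proof.
move=> a f g; apply: dualP => x.
rewrite [RHS]dual_addE !dual_scale_funE -big_split.
by apply: eq_bigr => h _; rewrite dual_addE mulrDr.
Qed.

Fact dual_scaleDl f : {morph dual_scale^~ f : a b / a + b}.
Proof.
move=> a b; apply: dualP => x.
rewrite [RHS]dual_addE !dual_scale_funE -big_split.
by apply: eq_bigr => h _; rewrite ga_coefD mulrDl.
Qed.

HB.instance Definition _ := GRing.Zmodule_isLmodule.Build FG D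
  dual_scaleA dual_scale1 dual_scaleDr dual_scaleDl.

End Dual.

Variant form_kind := TraceEuclidean | TraceHermitian.

Section Forms.
Variables (F : finFieldType) (K : fieldExtType F) (G : finGroupType).
Local Notation FG := (group_algebra F G).
Local Notation V := (ambient K G).
Local Notation Kf := (finvect_type K).

(* galTrace is K-valued, with values in the line F.1; fieldTr reads it in F.  *)
(* The pick is never empty (fieldTrE).  The alias finvect_type K carries the  *)
(* splittingFieldType structure that galTrace needs.                          *)
Definition fieldTr (a : K) : F :=
  odflt 0 [pick c : F | c%:A == galTrace 1 {: Kf} (a : Kf)].

Lemma fieldTrE a : (fieldTr a)%:A = galTrace 1 {: Kf} (a : Kf) :> Kf.
Proof.
rewrite /fieldTr; case: pickP => [c /eqP //|no].
have /vlineP[c e] : galTrace 1 {: Kf} (a : Kf) \in (1%VS : {vspace Kf}).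
  by apply: mem_galTrace; [apply: finField_galois; apply: sub1v | apply: memvf].
by have := no c; rewrite e eqxx.
Qed.

Lemma fieldTrD : {morph fieldTr : a b / a + b}.
Proof.
move=> a b; apply: (fmorph_inj (in_alg Kf)); rewrite rmorphD /= !fieldTrE.
exact: raddfD.
Qed.

Lemma fieldTrZ c a : fieldTr (c *: a) = c * fieldTr a.
Proof.
apply: (fmorph_inj (in_alg Kf)); rewrite rmorphM /= !fieldTrE.
rewrite mulr_algl /galTrace scaler_sumr; apply: eq_bigr => s _.
exact: linearZ.
Qed.

(* b |-> b ^ (q ^ (m / 2)); meaningful when m = [K : F] is even. *)
Definition hconj (b : K) : K := b ^+ (#|F| ^ (\dim {: K})./2).

Definition trace_form (star : form_kind) (x y : V) : F :=
  fieldTr (\sum_(g : G) @ga_coef K G x g *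
    (if star is TraceHermitian then hconj (@ga_coef K G y g)
     else @ga_coef K G y g)).

Variables (star : form_kind) (C : submodClosed V).

Definition perp : {pred V} :=
  fun x => `[< forall c, c \in C -> trace_form star x c = 0 >].

Lemma perpP x :
  reflect (forall c, c \in C -> trace_form star x c = 0) (x \in perp).
Proof. exact: asboolP. Qed.

Lemma trace_formDl x y z :
  trace_form star (x + y) z = trace_form star x z + trace_form star y z.
Proof.
rewrite /trace_form -fieldTrD -big_split; congr fieldTr.
by apply: eq_bigr => g _; rewrite [ga_coef _ _]ga_coefD mulrDl.
Qed.

Lemma trace_formZl (a : FG) (x z : V) :
  trace_form star (a *: x) z
  = \sum_(h : G) ga_coef a h * trace_form star x (ga_elt h^-1%g *: z).
Proof.
pose conj b := if star is TraceHermitian then hconj b else b.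
have eltZ h (y : V) g :
    @ga_coef K G (ga_elt h^-1%g *: y) g = @ga_coef K G y (h * g)%g.
  rewrite ambient_coefZ (bigD1 h^-1%g) //= big1 ?addr0.
    by rewrite ga_coef_elt eqxx scale1r mul1r invgK.
  by move=> k /negbTE; rewrite ga_coef_elt => ->; rewrite scale0r mul0r.
have fieldTr0 : fieldTr 0 = 0 by rewrite -(scale0r 0) fieldTrZ mul0r.
under eq_bigr do rewrite -fieldTrZ.
rewrite /trace_form -(big_morph _ fieldTrD fieldTr0); congr fieldTr.
under [LHS]eq_bigr do rewrite ambient_coefZ mulr_suml.
rewrite exchange_big; apply: eq_bigr => h _ /=.
rewrite (reindex_inj (mulgI h)) scaler_sumr; apply: eq_bigr => g _.
by rewrite mulKg eltZ mulr_algl scalerAl.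
Qed.

Fact perp_submod : submod_closed perp.
Proof.
have perpZ (a : FG) x : x \in perp -> a *: x \in perp.
  move=> /perpP xC; apply/perpP => c cC; rewrite trace_formZl big1 // => h _.
  by rewrite xC ?mulr0 // rpredZ.
have perp0 : 0 \in perp.
  apply/perpP => c _.
  by apply: (addrI (trace_form star 0 c)); rewrite -trace_formDl !addr0.
split=> // a x y /perpZ -/(_ a)/perpP xC /perpP yC; apply/perpP => c cC.
by rewrite trace_formDl xC // yC // addr0.
Qed.
HB.instance Definition _ := GRing.isSubmodClosed.Build FG V perp
  perp_submod.

End Forms.

(* Main.v *)
(* The kernel of x |-> <x, ->|_C is C^perp by definition, so only surjectivity *)
(* onto C^* needs an argument.  A functional on the F-subspace C extends to    *)
(* KG; on each coordinate line K.g it is b |-> Tr (a b) (resp. b conjugated)   *)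
(* for some a, because this pairing on K is nondegenerate and K is finite      *)
(* dimensional.                                                                *)
From HB Require Import structures.
Require Import Defs.
From mathcomp Require Import all_boot all_fingroup all_algebra all_field.

Set Implicit Arguments.
Unset Strict Implicit.
Unset Printing Implicit Defensive.

Import GRing.Theory.
Local Open Scope ring_scope.

(** Sending [x] to the functional [trace_form star x] on [C] induces the isomorphism. It is
    [FG]-linear because moving a group element across the form inverts it ([trace_formZl]), exactly
    as the dual action prescribes. Injectivity is the definition of [perp]. Surjectivity combines
    [dual_extends], which prolongs a functional from [C] to all of [KG], with
    [trace_form_represents], which solves for [x] one coordinate at a time by
    [pairing_represents]. *)

Lemma vspace_of_closed (F : fieldType) (vT : vectType F) (s : seq vT)
    (P : {pred vT}) (P0 : 0 \in P)
    (PD : forall x y, x \in P -> y \in P -> x + y \in P)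
    (PZ : forall (c : F) x, x \in P -> c *: x \in P) :
  {subset P <= s} -> exists U : {vspace vT}, U =i P.
Proof.
(* The subspace is spanned by the members of [P] listed in [s]; closure under linear combinations
   keeps this span inside [P]. *)
move=> sP; exists <<[seq x <- s | x \in P]>>%VS => x; apply/idP/idP; last first.
  by move=> xP; apply: memv_span; rewrite mem_filter xP sP.
move/(@coord_span _ _ _ (in_tuple _)) ->.
elim/big_ind: _ => // i _; apply: PZ.
by have := mem_nth 0 (ltn_ord i); rewrite mem_filter => /andP[].
Qed.

(** Precompose [u] with a projection onto [U]. *)
Lemma extend_linear (F : fieldType) (vT : vectType F) (U : {vspace vT})
    (u : vT -> F) (uD : {in U &, {morph u : x y / x + y}})
    (uZ : forall c, {in U, forall x, u (c *: x) = c * u x}) :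
  exists l : {linear vT -> F^o}, {in U, l =1 u}.
Proof.
have ul : linear (fun x => u (projv U x) : F^o).
  by move=> c x y; rewrite linearP uD ?uZ ?memvZ ?memv_proj.
exists (HB.pack_for {linear vT -> F^o} (fun x => u (projv U x) : F^o)
  (GRing.isLinear.Build F vT F^o _ (fun x => u (projv U x) : F^o) ul)).
by move=> x xU /=; rewrite projv_id.
Qed.

Section Pairing.
Variables (F : finFieldType) (K : fieldExtType F) (star : form_kind).
Implicit Types a b : K.

Definition star_conj b := if star is TraceHermitian then hconj b else b.

(** The exponent is a power of [#|F|], hence of the characteristic, so [hconj] is an iterate of
    Frobenius. *)
Lemma hconjD : {morph @hconj F K : a b / a + b}.
Proof.
have [p p_pr pF] := finPcharP F.
have pK : p \in [pchar K] by rewrite (fmorph_pchar (in_alg K)).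
move=> a b; apply: exprDn_pchar; rewrite pnatX; apply/orP; left.
rewrite (eq_pnat _ (pcharf_eq pK)).
by rewrite (card_pprimeChar pF) pnatX pnat_id.
Qed.

Lemma hconjZ c b : hconj (c *: b) = c *: hconj b.
Proof.
rewrite /hconj exprZn; congr (_ *: _).
by elim: _./2 => [|k IHk]; rewrite ?expr1 // expnS exprM expf_card.
Qed.

Lemma star_conjD : {morph star_conj : a b / a + b}.
Proof. by rewrite /star_conj; case: star => // a b; apply: hconjD. Qed.

Lemma star_conjZ c b : star_conj (c *: b) = c *: star_conj b.
Proof. by rewrite /star_conj; case: star => //; apply: hconjZ. Qed.

Lemma star_conj_eq0 b : star_conj b = 0 -> b = 0.
Proof.
rewrite /star_conj; case: star => // /eqP.
by rewrite expf_eq0 => /andP[_ /eqP].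
Qed.

(** An injective self-map of the finite set [K] is onto; [finvect_type K] supplies the finite
    structure. *)
Lemma star_conj_surj b : exists a, star_conj a = b.
Proof.
have inj : injective (star_conj : finvect_type K -> finvect_type K).
  move=> x y e; apply/eqP; rewrite -subr_eq0; apply/eqP.
  apply: star_conj_eq0; rewrite -scaleN1r star_conjD star_conjZ e.
  by rewrite scaleN1r subrr.
by exists (invF inj b); rewrite f_invF.
Qed.

(* Dedekind: the automorphisms summed in the trace are linearly independent. *)
Lemma fieldTr_neq0 : exists t : K, fieldTr t != 0.
Proof.
pose Kf := finvect_type K.
have [t _ tr_t] := @gal_independent_contra F Kf {: Kf}
  [in 'Gal({: Kf} / 1)%g] (fun=> 1) _ (group1 _) (oner_neq0 _).
exists t; apply: contraNneq tr_t => tr0; apply/eqP.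
under eq_bigr do rewrite mul1r.
by have := @fieldTrE F K t; rewrite tr0 scale0r => /esym.
Qed.

(** If [a] is nonzero, some [b] has conjugate [a^-1 * t] with [t] of nonzero trace, so [a] pairs
    with [b] to a nonzero value. *)
Lemma pairing_nondeg a :
  (forall b, fieldTr (a * star_conj b) = 0) -> a = 0.
Proof.
move=> a0; apply/eqP; have [t] := fieldTr_neq0; apply: contraNT => a_neq0.
have [b eb] := star_conj_surj (a^-1 * t).
by have := a0 b; rewrite eb mulVKf // => ->.
Qed.

(** The map [R] from [K] to its [F]-dual is linear and injective by [pairing_nondeg]; both sides
    have the same dimension, so it is onto. *)
Lemma pairing_represents (l : {linear K -> F^o}) :
  exists a, forall b, fieldTr (a * star_conj b) = l b.
Proof.
pose T a b : F^o := fieldTr (a * star_conj b).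
have Tr a : linear (T a).
  move=> c x y; rewrite /T star_conjD star_conjZ mulrDr fieldTrD.
  by rewrite -scalerAr fieldTrZ.
pose TL a : {linear K -> F^o} := HB.pack_for {linear K -> F^o} (T a)
  (GRing.isLinear.Build F K F^o _ (T a) (Tr a)).
pose R a : 'Hom(K, F^o) := linfun (TL a).
have RE a b : R a b = fieldTr (a * star_conj b) by rewrite /R lfunE.
have Rl : linear R.
  move=> c x y; apply/lfunP => b; rewrite add_lfunE scale_lfunE !RE.
  by rewrite mulrDl fieldTrD -scalerAl fieldTrZ.
pose RL : {linear K -> 'Hom(K, F^o)} := HB.pack_for {linear K -> 'Hom(K, F^o)} R
  (GRing.isLinear.Build F K 'Hom(K, F^o) _ R Rl).
have ker0 : (fullv :&: lker (linfun RL) = 0)%VS.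
  apply/eqP; rewrite -subv0; apply/subvP => a; rewrite memv_cap memv_ker.
  case/andP => _ /eqP; rewrite lfunE /= => /lfunP Ra0.
  by rewrite memv0; apply/eqP/pairing_nondeg => b; rewrite -RE Ra0 lfunE.
have : linfun l \in limg (linfun RL).
  suff /eqP -> : limg (linfun RL) == fullv by apply: memvf.
  rewrite eqEdim subvf (limg_dim_eq ker0) !dimvf.
  by rewrite /dim /= muln1.
case/memv_imgP => a _; rewrite lfunE /= => e.
by exists a => b; rewrite -RE -e lfunE.
Qed.

End Pairing.

Section Form.
Variables (F : finFieldType) (K : fieldExtType F) (G : finGroupType).
Variable star : form_kind.
Local Notation FG := (group_algebra F G).
Local Notation V := (ambient K G).
Implicit Types x y : V.

Lemma trace_formE x y : trace_form star x y
  = \sum_g fieldTr (@ga_coef K G x g * star_conj star (@ga_coef K G y g)).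
Proof.
apply: (big_morph _ (@fieldTrD F K)).
by rewrite -(scale0r 0) fieldTrZ mul0r.
Qed.

Lemma ambient_coef_alg (c : F) x g :
  @ga_coef K G ((c%:A : FG) *: x) g = c *: @ga_coef K G x g.
Proof.
rewrite ambient_coefZ (bigD1 1%g) //= big1 ?addr0 => [|h /negbTE nh].
  by rewrite ga_coefZ -ga_elt1 ga_coef_elt eqxx mulr1 invg1 mul1g mulr_algl.
by rewrite ga_coefZ -ga_elt1 ga_coef_elt nh mulr0 scale0r mul0r.
Qed.

Lemma trace_formDr x : {morph trace_form star x : y z / y + z}.
Proof.
move=> y z; rewrite !trace_formE -big_split; apply: eq_bigr => g _ /=.
by rewrite [@ga_coef K G (y + z) g]ga_coefD star_conjD mulrDr fieldTrD.
Qed.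

Lemma trace_formZr x (c : F) y :
  trace_form star x ((c%:A : FG) *: y) = c * trace_form star x y.
Proof.
rewrite !trace_formE mulr_sumr; apply: eq_bigr => g _.
by rewrite ambient_coef_alg star_conjZ -scalerAr fieldTrZ.
Qed.

Lemma trace_form_represents (l : {linear {ffun G -> K} -> F^o}) :
  exists x, forall y, trace_form star x y = l y.
Proof.
(* [d g] embeds [K] as the coordinate line at [g]; representing [l] on each line gives the
   coefficients of [x]. *)
pose d g (b : K) : {ffun G -> K} := [ffun h => if h == g then b else 0].
have dl g : linear (fun b => l (d g b)).
  move=> c a b; rewrite -linearP; congr (l _); apply/ffunP => h.
  by rewrite !ffunE; case: ifP; rewrite ?scaler0 ?addr0.
pose L g : {linear K -> F^o} := HB.pack_for {linear K -> F^o}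
  (fun b => l (d g b)) (GRing.isLinear.Build F K F^o _ _ (dl g)).
have [a aE] := fin_all_exists (fun g => pairing_represents star (L g)).
exists [ffun g => a g] => y; rewrite trace_formE.
have {2}-> : (y : {ffun G -> K}) = \sum_g d g (@ga_coef K G y g).
  apply/ffunP => h; rewrite sum_ffunE (bigD1 h) //= big1 ?addr0.
    by rewrite ffunE eqxx.
  by move=> g; rewrite eq_sym ffunE => /negbTE ->.
rewrite linear_sum; apply: eq_bigr => g _.
by rewrite [@ga_coef K G (finfun _) g]ffunE aE.
Qed.

Variable C : submodClosed V.

(** Viewed over [F], the code is a subspace of [{ffun G -> K}], where scaling by [c] agrees with the
    action of [c%:A] in [FG]; this reduces the claim to [extend_linear]. *)
Lemma dual_extends (f : dual (submod C)) :
  exists l : {linear {ffun G -> K} -> F^o}, forall c, l (val c) = dual_fun f c.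
Proof.
pose E : vectType F := {ffun G -> K}.
have algE (c : F) (x : E) : c *: x = ((c%:A : FG) *: (x : V) : V).
  by apply/ffunP => g; rewrite ffunE; apply/esym/ambient_coef_alg.
have [U UC] : exists U : {vspace E}, U =i (fun x => (x : V) \in C).
  apply: (@vspace_of_closed _ _ (enum {ffun G -> finvect_type K})).
  - exact: (rpred0 C).
  - by move=> x y; apply: (@rpredD _ C).
  - by move=> c x xC; rewrite unfold_in algE; apply: rpredZ.
  by move=> x _; rewrite mem_enum.
(* The value 0 outside [C] is a placeholder: [extend_linear] only looks at [u] on [U]. *)
pose u (x : E) : F :=
  if insub (x : V) is Some c then dual_fun f (c : submod C) else 0.
have uval (c : submod C) : u (val c) = dual_fun f c by rewrite /u valK.
have memC x : x \in U -> exists c : submod C, val c = x.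
  by rewrite UC => xC; exists (Sub (x : V) xC); rewrite SubK.
have [||l lu] := @extend_linear _ E U u.
- move=> _ _ /memC[x <-] /memC[y <-]; rewrite !uval -dual_funD -uval.
  by congr u.
- by move=> c _ /memC[x <-]; rewrite !uval -dual_funZ -uval algE; congr u.
by exists l => c; rewrite lu ?uval // UC; apply: (valP c).
Qed.

End Form.

Theorem proposition4p2 (F : finFieldType) (K : fieldExtType F) (m : nat)
  (hm : \dim {: K} = m) (G : finGroupType) (C : submodClosed (ambient K G))
  (star : form_kind) (hstar : star = TraceHermitian -> ~~ odd m) :
  exists phi : {linear quotmod (perp star C) -> dual (submod C)},
    bijective phi /\
    forall (x : ambient K G) (c : submod C),
      dual_fun (phi (to_quot (perp star C) x)) c = trace_form star x (val c).
Proof.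
set N := perp star C.
have uD x : {morph (fun c : submod C => trace_form star x (val c)) :
    c d / c + d} by move=> c d; apply: trace_formDr.
have uZ x c (d : submod C) :
  trace_form star x (val (c%:A *: d)) = c * trace_form star x (val d).
  exact: trace_formZr.
pose u x := mk_dual (uD x) (uZ x).
have trB x y z : trace_form star (x - y) z
    = trace_form star x z - trace_form star y z.
  by apply: (addIr (trace_form star y z)); rewrite -trace_formDl !subrK.
(* One direction gives injectivity on the quotient, the other independence of the chosen
   representative. *)
have uN x y : (u x = u y) <-> (to_quot N x = to_quot N y).
  split=> [e|/to_quot_eq /perpP e].
    apply/to_quot_eq/perpP => c cC; rewrite trB.
    have := congr1 (fun f => dual_fun f (Sub c cC)) e.
    by rewrite !mk_dualE SubK => ->; rewrite subrr.
  apply: dualP => c; rewrite !mk_dualE.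
  by apply/eqP; rewrite -subr_eq0 -trB; apply/eqP/e/(valP c).
pose phi (q : quotmod N) := u (generic_quotient.repr q).
have phiE x : phi (to_quot N x) = u x.
  by apply/uN; rewrite [LHS]generic_quotient.reprK.
have phil : linear phi.
  move=> a q r; have [x <-] := to_quot_surj q; have [y <-] := to_quot_surj r.
  have -> : a *: to_quot N x + to_quot N y = to_quot N (a *: x + y).
    by rewrite to_quotD -quot_scaleE.
  rewrite !phiE; apply: dualP => c.
  rewrite dual_addE !mk_dualE trace_formDl; congr (_ + _).
  (* After [trace_formZl], both sides are the sum over [h] that defines the dual action, with [h^-1]
     applied to [c]. *)
  by rewrite trace_formZl; apply: eq_bigr.
exists (HB.pack_for {linear quotmod N -> dual (submod C)} phi
  (GRing.isLinear.Build _ _ _ _ phi phil)); split; last first.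
  by move=> x c; rewrite -[LHS]/(dual_fun (phi (to_quot N x)) c) phiE.
have surj (f : dual (submod C)) : exists x, u x = f.
  have [l lf] := dual_extends f; have [x xl] := trace_form_represents star l.
  by exists x; apply: dualP => c; rewrite mk_dualE xl.
(* A chosen preimage for every functional yields the two-sided inverse. *)
have [s sE] := boolp.choice surj.
exists (fun f => to_quot N (s f)) => [q|f] /=; last by rewrite phiE.
have [x <-] := to_quot_surj q; apply/uN; rewrite sE; exact: phiE.
Qed.
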